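(* Let $X$ be a finite regular cell complex, $\mathbb V$ a vector space, and $\underline{\mathbb V}$ the constant sheaf on $X$ with stalk $\mathbb V$. If a cellular sheaf $\mathcal F$ on $X$ is a $0$-approximation to $\underline{\mathbb V}$, then $\mathcal F$ is isomorphic to a cellular sheaf $\mathcal F'$ on $X$ with all vertex stalks equal to $\mathbb V$ such that, for each edge $e$ joining vertices $v$ and $w$, the restriction maps $\mathcal F'_{v\trianglelefteq e}:\mathbb V\to\mathcal F'(e)$ and $\mathcal F'_{w\trianglelefteq e}:\mathbb V\to\mathcal F'(e)$ are equal.
   Context: A regular cell complex is identified with its face poset; $\sigma\trianglelefteq\tau$ means that the cell $\sigma$ is contained in the closure of $\tau$. A cellular sheaf $\mathcal F$ on $X$ assigns to each cell $\sigma$ a finite-dimensional vector space $\mathcal F(\sigma)$ over a field $\Bbbk$ (its stalk) and to each $\sigma\trianglelefteq\tau$ a linear restriction map $\mathcal F_{\sigma\trianglelefteq\tau}:\mathcal F(\sigma)\to\mathcal F(\tau)$ with $\mathcal F_{\sigma\trianglelefteq\sigma}=\mathrm{id}$ and $\mathcal F_{\rho\trianglelefteq\tau}=\mathcal F_{\sigma\trianglelefteq\tau}\circ\mathcal F_{\rho\trianglelefteq\sigma}$ for $\rho\trianglelefteq\sigma\trianglelefteq\tau$. A sheaf morphism $\varphi:\mathcal G\to\mathcal F$ is a family of linear maps $\varphi_\sigma:\mathcal G(\sigma)\to\mathcal F(\sigma)$ with $\varphi_\tau\circ\mathcal G_{\sigma\trianglelefteq\tau}=\mathcal F_{\sigma\trianglelefteq\tau}\circ\varphi_\sigma$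 whenever $\sigma\trianglelefteq\tau$; it is an isomorphism if every $\varphi_\sigma$ is invertible. The constant sheaf $\underline{\mathbb V}$ has all stalks $\mathbb V$ and all restriction maps the identity. $H^i(X;\mathcal F)$ is the cohomology of the cochain complex $C^k(X;\mathcal F)=\bigoplus_{\dim\sigma=k}\mathcal F(\sigma)$ with $(\delta^kx)_\tau=\sum_{\dim\sigma=k}[\sigma:\tau]\mathcal F_{\sigma\trianglelefteq\tau}(x_\sigma)$, where $[\sigma:\tau]$ is a signed incidence relation from orientations of cells; sheaf morphisms induce maps on $H^i$. A sheaf $\mathcal F$ is a $k$-approximation to a sheaf $\mathcal G$ if there is a sheaf morphism $a:\mathcal G\to\mathcal F$ which is an isomorphism on stalks over cells of dimension at most $k$ and which induces an isomorphism $H^i(X;\mathcal G)\to H^i(X;\mathcal F)$ for all $i\le k$. *)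

(* Defs.v *)
From HB Require Import structures.
From mathcomp Require Import all_boot all_order all_algebra.
From mathcomp Require Import generic_quotient ring_quotient.
From mathcomp Require Import boolp classical_sets functions reals.
From mathcomp Require Import topology normedtype.

Set Implicit Arguments.
Unset Strict Implicit.
Unset Printing Implicit Defensive.

Import GRing.Theory Num.Theory numFieldNormedType.Exports.
Local Open Scope classical_set_scope.
Local Open Scope quotient_scope.
Local Open Scope ring_scope.

(* Euclidean balls: the canonical norm of 'rV[R]_n is the sup norm, hence the
   explicit sum of squares. For n = 0 both balls are the single point. *)
Definition closed_disk (R : realType) (n : nat) : set 'rV[R]_n :=
  [set x | \sum_i x ord0 i ^+ 2 <= 1].

Definition open_disk (R : realType) (n : nat) : set 'rV[R]_n :=
  [set x | \sum_i x ord0 i ^+ 2 < 1].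

Definition homeomorphism_between (T U : topologicalType)
    (A : set T) (B : set U) (f : T -> U) : Prop :=
  [/\ f @` A = B, {within A, continuous f} &
      exists g : U -> T,
        [/\ g @` B = A, {within B, continuous g},
            {in A, cancel f g} & {in B, cancel g f}]].

Record finite_regular_complex (R : realType) := FiniteRegularComplex {
  space : topologicalType;
  cells : finType;
  cell_dim : cells -> nat;
  open_cell : cells -> set space;
  space_hausdorff : hausdorff_space space;
  cells_cover : \bigcup_(s in [set: cells]) open_cell s = [set: space];
  cells_disjoint : trivIset [set: cells] open_cell;
  cells_frontier : forall s t : cells, s <> t ->
    open_cell s `&` closure (open_cell t) !=set0 ->
    open_cell s `<=` closure (open_cell t) /\ (cell_dim s < cell_dim t)%N;
  cells_regular : forall s : cells, exists chi : 'rV[R]_(cell_dim s) -> space,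
    homeomorphism_between (@closed_disk R (cell_dim s))
      (closure (open_cell s)) chi
    /\ chi @` @open_disk R (cell_dim s) = open_cell s
}.

Definition face (R : realType) (X : finite_regular_complex R)
    (s t : cells X) : Prop :=
  open_cell s `<=` closure (open_cell t).

Notation "s ⊴ t" := (face s t) (at level 70, no associativity).

(* On a regular complex, the functions satisfying these conditions are exactly
   the incidence numbers coming from orientations of the cells, the vertices
   being oriented positively (Lundell-Weingram, Cooke-Finney). *)
Record signed_incidence (R : realType) (X : finite_regular_complex R) :=
  SignedIncidence {
  inc : cells X -> cells X -> int;
  inc_sign : forall s t, s ⊴ t -> cell_dim t = (cell_dim s).+1 ->
    inc s t = 1 \/ inc s t = -1;
  inc_face : forall s t, inc s t <> 0 -> s ⊴ t /\ cell_dim t = (cell_dim s).+1;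
  inc_edge : forall v w e,
    cell_dim e = 1%N -> cell_dim v = 0%N -> cell_dim w = 0%N ->
    v <> w -> v ⊴ e -> w ⊴ e -> inc v e + inc w e = 0;
  inc_diamond : forall s t, \sum_(u : cells X) inc s u * inc u t = 0
}.

(* [res s t] is only meaningful when s ⊴ t; its other values are irrelevant
   junk, ignored by every notion below. *)
Record sheaf (R : realType) (X : finite_regular_complex R) (k : fieldType) :=
  Sheaf {
  stalk : cells X -> vectType k;
  res : forall s t, 'Hom(stalk s, stalk t);
  res_id : forall s, res s s = \1%VF;
  res_comp : forall r s t, r ⊴ s -> s ⊴ t ->
    res r t = (res s t \o res r s)%VF
}.

Record sheaf_hom (R : realType) (X : finite_regular_complex R) (k : fieldType)
    (G F : sheaf X k) := SheafHom {
  component : forall s, 'Hom(stalk G s, stalk F s);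
  component_res : forall s t, s ⊴ t ->
    (component t \o res G s t)%VF = (res F s t \o component s)%VF
}.

Definition sheaf_isomorphic (R : realType) (X : finite_regular_complex R)
    (k : fieldType) (G F : sheaf X k) : Prop :=
  exists phi : sheaf_hom G F, forall s, bijective (component phi s).

Definition constant_sheaf (R : realType) (X : finite_regular_complex R)
    (k : fieldType) (V : vectType k) : sheaf X k :=
  @Sheaf R X k (fun=> V) (fun _ _ => \1%VF) (fun=> erefl)
    (fun _ _ _ _ _ => esym (comp_lfun1l \1%VF)).

Section Cochains.
Variables (R : realType) (X : finite_regular_complex R) (k : fieldType).

Definition cochain (F : sheaf X k) (i : nat) : Type :=
  forall s : {s : cells X | cell_dim s == i}, stalk F (val s).

Section Module.
Variables (F : sheaf X k) (i : nat).
Local Notation C := (cochain F i).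

HB.instance Definition _ := gen_eqMixin C.
HB.instance Definition _ := gen_choiceMixin C.

Fact eq_cochain (x y : C) : (forall s, x s = y s) -> x = y.
Proof. exact: functional_extensionality_dep. Qed.

Definition cochain0 : C := fun=> 0.
Definition cochain_opp (x : C) : C := fun s => - x s.
Definition cochain_add (x y : C) : C := fun s => x s + y s.
Definition cochain_scale (a : k) (x : C) : C := fun s => a *: x s.

Fact cochain_addA : associative cochain_add.
Proof. by move=> x y z; apply: eq_cochain => s; exact: addrA. Qed.
Fact cochain_addC : commutative cochain_add.
Proof. by move=> x y; apply: eq_cochain => s; exact: addrC. Qed.
Fact cochain_add0 : left_id cochain0 cochain_add.
Proof. by move=> x; apply: eq_cochain => s; exact: add0r. Qed.
Fact cochain_addN : left_inverse cochain0 cochain_opp cochain_add.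
Proof. by move=> x; apply: eq_cochain => s; exact: addNr. Qed.

HB.instance Definition _ := GRing.isZmodule.Build C
  cochain_addA cochain_addC cochain_add0 cochain_addN.

Fact cochain_scaleA a b (x : C) :
  cochain_scale a (cochain_scale b x) = cochain_scale (a * b) x.
Proof. by apply: eq_cochain => s; exact: scalerA. Qed.
Fact cochain_scale1 : left_id 1 cochain_scale.
Proof. by move=> x; apply: eq_cochain => s; exact: scale1r. Qed.
Fact cochain_scaleDr : right_distributive cochain_scale +%R.
Proof. by move=> a x y; apply: eq_cochain => s; exact: scalerDr. Qed.
Fact cochain_scaleDl x : {morph cochain_scale^~ x : a b / a + b}.
Proof. by move=> a b; apply: eq_cochain => s; exact: scalerDl. Qed.

HB.instance Definition _ := GRing.Zmodule_isLmodule.Build k C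
  cochain_scaleA cochain_scale1 cochain_scaleDr cochain_scaleDl.

Lemma cochainDE (x y : C) s : (x + y) s = x s + y s. Proof. by []. Qed.
Lemma cochainZE a (x : C) s : (a *: x) s = a *: x s. Proof. by []. Qed.

End Module.

Variable I : signed_incidence X.

Definition delta (F : sheaf X k) (i : nat) (x : cochain F i) : cochain F i.+1 :=
  fun t => \sum_(s : {s : cells X | cell_dim s == i})
    (inc I (val s) (val t))%:~R *: res F (val s) (val t) (x s).

Fact delta_linear (F : sheaf X k) i : linear (@delta F i).
Proof.
move=> a x y; apply: eq_cochain => t.
rewrite cochainDE cochainZE /delta scaler_sumr -big_split /=.
apply: eq_bigr => s _; rewrite cochainDE cochainZE linearP scalerDr.
by rewrite !scalerA mulrC.
Qed.

HB.instance Definition _ (F : sheaf X k) i :=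
  GRing.isLinear.Build k (cochain F i) (cochain F i.+1) _ (@delta F i)
    (@delta_linear F i).

Lemma delta_delta (F : sheaf X k) i (x : cochain F i) : delta (delta x) = 0.
Proof.
apply: eq_cochain => t; rewrite [RHS]/(0 t) /delta.
under eq_bigr => u _ do rewrite linear_sum scaler_sumr.
rewrite exchange_big /= big1 // => s _.
have termE (u : {u : cells X | cell_dim u == i.+1}) :
    (inc I (val u) (val t))%:~R *: res F (val u) (val t)
      ((inc I (val s) (val u))%:~R *: res F (val s) (val u) (x s))
    = (inc I (val s) (val u) * inc I (val u) (val t))%:~R
        *: res F (val s) (val t) (x s).
  rewrite linearZ scalerA -intrM mulrC.
  have [->|/eqP nz] := eqVneq (inc I (val s) (val u) * inc I (val u) (val t)) 0.
    by rewrite !scale0r.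
  have /inc_face[su _] : inc I (val s) (val u) <> 0.
    by move=> su0; apply: nz; rewrite su0 mul0r.
  have /inc_face[ut _] : inc I (val u) (val t) <> 0.
    by move=> ut0; apply: nz; rewrite ut0 mulr0.
  by rewrite (res_comp F su ut) comp_lfunE.
rewrite (eq_bigr _ (fun u _ => termE u)) -scaler_suml -rmorph_sum /=.
suff -> : \sum_(u : {u | cell_dim u == i.+1})
    inc I (val s) (val u) * inc I (val u) (val t) = 0 by rewrite scale0r.
rewrite -[RHS](inc_diamond I (val s) (val t)).
rewrite [RHS](bigID (fun u => cell_dim u == i.+1)) /= [X in _ = _ + X]big1 ?addr0.
  by rewrite [RHS](reindex_omap (val : {u | cell_dim u == i.+1} -> _) insub) /=;
    [apply: eq_bigl => u; rewrite valK (valP u) eqxx | move=> u hu; rewrite insubT].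
move=> u hu; have [->|/eqP/inc_face[_ du]] := eqVneq (inc I (val s) u) 0.
  by rewrite mul0r.
by rewrite du (eqP (valP s)) eqxx in hu.
Qed.

Section Cohomology.
Variables (F : sheaf X k) (i : nat).

Definition cocycle : {pred cochain F i} := [pred x | delta x == 0].

Fact cocycle_submod : submod_closed cocycle.
Proof.
split=> [|a x y xZ yZ]; first by apply/eqP; exact: linear0.
have /eqP dx : delta x == 0 := xZ; have /eqP dy : delta y == 0 := yZ.
by apply/eqP; rewrite linearP /= dx dy scaler0 addr0.
Qed.
HB.instance Definition _ :=
  GRing.isSubmodClosed.Build k (cochain F i) cocycle cocycle_submod.

Definition cocycles : Type := {x : cochain F i | x \in cocycle}.
HB.instance Definition _ := SubChoice.on cocycles.
HB.instance Definition _ := [SubChoice_isSubLmodule of cocycles by <:].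
End Cohomology.
Arguments cocycle F i : clear implicits.

Definition is_coboundary (F : sheaf X k) (i : nat) : cochain F i -> Prop :=
  if i is j.+1 then fun x => exists y : cochain F j, x = delta y
  else fun x => x = 0.

Definition coboundary (F : sheaf X k) (i : nat) : {pred cocycles F i} :=
  [pred z | `[< is_coboundary (val z) >]].

Arguments coboundary F i : clear implicits.

Fact coboundaryP (F : sheaf X k) i (z : cocycles F i) :
  reflect (is_coboundary (val z)) (z \in coboundary F i).
Proof. exact: asboolP. Qed.

Fact coboundary_submod (F : sheaf X k) i : submod_closed (coboundary F i).
Proof.
split=> [|a x y /coboundaryP + /coboundaryP +]; last first.
  case: i x y => [|i] x y /=; first move=> x0 y0.
    by apply/coboundaryP; rewrite /= x0 y0 scaler0 addr0.
  move=> [x' xE] [y' yE]; apply/coboundaryP.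
  by exists (a *: x' + y'); rewrite [RHS]linearP /= -xE -yE.
apply/coboundaryP; case: i => [|i] //=.
by exists 0; rewrite linear0.
Qed.
HB.instance Definition _ (F : sheaf X k) i :=
  GRing.isSubmodClosed.Build k (cocycles F i) (coboundary F i)
    (@coboundary_submod F i).

(* The library only makes this quotient a zmodType; the scalar action is added
   below. *)
Definition cohomology (F : sheaf X k) (i : nat) : Type :=
  Quotient.quot (coboundary F i).

Section CohomologyModule.
Variables (F : sheaf X k) (i : nat).
Local Notation H := (cohomology F i).
Local Notation piH := (\pi_(Quotient.quot (coboundary F i))).

HB.instance Definition _ := Choice.on H.
HB.instance Definition _ := GRing.Zmodule.on H.

Definition cohomology_class (z : cocycles F i) : H := piH z.

Fact cohomology_class_eq (x y : cocycles F i) :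
  cohomology_class x = cohomology_class y <-> x - y \in coboundary F i.
Proof. by rewrite Quotient.idealrBE; split=> [/eqP|/eqP]. Qed.

Fact cohomology_reprK (c : H) : cohomology_class (repr c) = c.
Proof. exact: reprK. Qed.

Fact cohomology_classD (x y : cocycles F i) :
  cohomology_class (x + y) = cohomology_class x + cohomology_class y.
Proof. exact: (raddfD piH). Qed.

Definition cohomology_scale (a : k) (c : H) : H :=
  cohomology_class (a *: repr c).

Fact cohomology_classZ a (x : cocycles F i) :
  cohomology_class (a *: x) = cohomology_scale a (cohomology_class x).
Proof.
apply/cohomology_class_eq; rewrite -scalerBr; apply: rpredZ.
by apply/cohomology_class_eq; rewrite cohomology_reprK.
Qed.

Fact cohomology_scaleA a b (c : H) :
  cohomology_scale a (cohomology_scale b c) = cohomology_scale (a * b) c.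
Proof.
by rewrite -[c]cohomology_reprK -!cohomology_classZ scalerA.
Qed.
Fact cohomology_scale1 : left_id 1 cohomology_scale.
Proof.
by move=> c; rewrite -[c]cohomology_reprK -cohomology_classZ scale1r.
Qed.
Fact cohomology_scaleDr : right_distributive cohomology_scale +%R.
Proof.
move=> a c d; rewrite -[c]cohomology_reprK -[d]cohomology_reprK.
by rewrite -cohomology_classD -!cohomology_classZ scalerDr cohomology_classD.
Qed.
Fact cohomology_scaleDl c : {morph cohomology_scale^~ c : a b / a + b}.
Proof.
move=> a b; rewrite -[c]cohomology_reprK -!cohomology_classZ.
by rewrite scalerDl cohomology_classD.
Qed.

HB.instance Definition _ := GRing.Zmodule_isLmodule.Build k H
  cohomology_scaleA cohomology_scale1 cohomology_scaleDr cohomology_scaleDl.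

End CohomologyModule.

Section InducedMap.
Variables (G F : sheaf X k) (phi : sheaf_hom G F) (i : nat).

Definition cochain_map (j : nat) (x : cochain G j) : cochain F j :=
  fun s => component phi (val s) (x s).

Fact cochain_map_linear j : linear (@cochain_map j).
Proof.
move=> a x y; apply: eq_cochain => s.
by rewrite cochainDE cochainZE /cochain_map cochainDE cochainZE linearP.
Qed.
HB.instance Definition _ j :=
  GRing.isLinear.Build k (cochain G j) (cochain F j) _ (@cochain_map j)
    (@cochain_map_linear j).

Fact cochain_map_delta j (x : cochain G j) :
  delta (cochain_map x) = cochain_map (delta x).
Proof.
apply: eq_cochain => t.
rewrite /delta /cochain_map linear_sum; apply: eq_bigr => s _ /=.
rewrite linearZ /=.
have [->|/eqP/inc_face[st _]] := eqVneq (inc I (val s) (val t)) 0.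
  by rewrite !scale0r.
by rewrite -comp_lfunE -(component_res phi st) comp_lfunE.
Qed.

Fact cochain_map_cocycle (z : cocycles G i) :
  cochain_map (val z) \in cocycle F i.
Proof.
have /eqP dz : delta (val z) == 0 := valP z.
by apply/eqP; rewrite cochain_map_delta dz linear0.
Qed.

Definition cocycle_map (z : cocycles G i) : cocycles F i :=
  Sub (cochain_map (val z)) (cochain_map_cocycle z).

Definition cohomology_map (c : cohomology G i) : cohomology F i :=
  cohomology_class (cocycle_map (repr c)).

Lemma cohomology_mapE (z : cocycles G i) :
  cohomology_map (cohomology_class z) = cohomology_class (cocycle_map z).
Proof.
apply/cohomology_class_eq; set z' := repr _.
have /coboundaryP zz' : z' - z \in coboundary G i.
  by apply/cohomology_class_eq; rewrite cohomology_reprK.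
apply/coboundaryP; have -> : val (cocycle_map z' - cocycle_map z)
    = cochain_map (val (z' - z)) by rewrite !raddfB.
move: (val (z' - z)) zz' => {z'} y; case: (i) y => [|j] y /=.
  by move=> ->; rewrite linear0.
by move=> [x ->]; exists (cochain_map x); rewrite cochain_map_delta.
Qed.

Fact cohomology_map_linear : linear cohomology_map.
Proof.
move=> a c d; rewrite -[c]cohomology_reprK -[d]cohomology_reprK.
rewrite -[a *: cohomology_class _]cohomology_classZ -cohomology_classD.
rewrite !cohomology_mapE.
rewrite -[a *: cohomology_class _]cohomology_classZ -cohomology_classD.
by congr cohomology_class; apply: val_inj; rewrite /= linearP.
Qed.
HB.instance Definition _ :=
  GRing.isLinear.Build k (cohomology G i) (cohomology F i) _ cohomology_map
    cohomology_map_linear.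

End InducedMap.

Definition is_approximation (n : nat) (F G : sheaf X k) : Prop :=
  exists a : sheaf_hom G F,
    (forall s, (cell_dim s <= n)%N -> bijective (component a s)) /\
    (forall i, (i <= n)%N -> bijective (@cohomology_map G F a i)).

End Cochains.

Definition stalk_eq_hom (k : fieldType) (V W U : vectType k) (e : V = W)
    (f : 'Hom(V, U)) : 'Hom(W, U) :=
  ecast T 'Hom(T, U) e f.

(* Main.v *)
(* Only the sheaf morphism a : V_X -> F and its invertibility on vertex stalks
   matter. Replacing every vertex stalk of F by V along the isomorphisms a_v
   turns F into an isomorphic sheaf F'; for v in the closure of an edge e,
   naturality of a gives F'_(v <= e) = F_(v <= e) o a_v = a_e, which does not
   depend on v. *)
Require Import Defs.
From mathcomp Require Import all_boot all_order all_algebra.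
From mathcomp Require Import reals.

(** [f^-1] is defined for every linear map; a trivial kernel makes it a left inverse. *)
Lemma bijective_lfunK {k : fieldType} {U W : vectType k} (f : 'Hom(U, W)) :
  bijective f -> cancel f (f^-1)%VF.
Proof. by move=> /bij_inj finj; apply: lker0_lfunK; apply/lker0P. Qed.

Lemma bijective_lfunVK {k : fieldType} {U W : vectType k} (f : 'Hom(U, W)) :
  bijective f -> cancel (f^-1)%VF f.
Proof.
by move=> fbij; have [g _ gK] := fbij => y; rewrite -(gK y) bijective_lfunK.
Qed.

(** The cast changes only the source, so it can be pushed onto the innermost factor of a transported
    restriction map, namely [of_model]. *)
Lemma stalk_eq_hom_comp {k : fieldType} {V W U T : vectType k} (e : V = W)
    (f : 'Hom(U, T)) (g : 'Hom(V, U)) :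
  stalk_eq_hom e (f \o g)%VF = (f \o stalk_eq_hom e g)%VF.
Proof. by case: W / e. Qed.

(** A replacement for one stalk with explicit inverse linear maps, so that stalks can be exchanged
    cell by cell. *)
Record stalk_model {k : fieldType} (U : vectType k) := StalkModel {
  model : vectType k;
  to_model : 'Hom(U, model);
  of_model : 'Hom(model, U);
  to_modelK : cancel to_model of_model;
  of_modelK : cancel of_model to_model
}.
Arguments model {k U}.
Arguments to_model {k U}.
Arguments of_model {k U}.
Arguments to_modelK {k U}.
Arguments of_modelK {k U}.

Lemma id_lfunK {k : fieldType} (U : vectType k) :
  cancel (\1%VF : 'Hom(U, U)) (\1%VF : 'Hom(U, U)).
Proof. by move=> x; rewrite !id_lfunE. Qed.

Definition trivial_model {k : fieldType} (U : vectType k) : stalk_model U :=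
  StalkModel _ _ _ _ _ (id_lfunK U) (id_lfunK U).

Definition bijective_model {k : fieldType} {U V : vectType k}
    (f : 'Hom(V, U)) (fbij : bijective f) : stalk_model U :=
  StalkModel _ _ V _ f (bijective_lfunVK f fbij) (bijective_lfunK f fbij).

Section Transport.
Variables (R : realType) (X : finite_regular_complex R) (k : fieldType).
Variables (F : sheaf X k) (M : forall s, stalk_model (stalk F s)).

Definition transport_res s t : 'Hom(model (M s), model (M t)) :=
  ((to_model (M t) \o res F s t) \o of_model (M s))%VF.

Fact transport_res_id s : transport_res s s = \1%VF.
Proof. by apply/lfunP => x; rewrite !comp_lfunE res_id !id_lfunE of_modelK. Qed.

(** The inner pair [of_model], [to_model] at [s] cancels. *)
Fact transport_res_comp r s t : r ⊴ s -> s ⊴ t ->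
  transport_res r t = (transport_res s t \o transport_res r s)%VF.
Proof.
move=> rs st; apply/lfunP => x.
by rewrite !comp_lfunE to_modelK (res_comp F rs st) comp_lfunE.
Qed.

Definition transport_sheaf : sheaf X k :=
  Sheaf transport_res_id transport_res_comp.

Fact to_model_res s t : s ⊴ t ->
  (to_model (M t) \o res F s t)%VF = (transport_res s t \o to_model (M s))%VF.
Proof. by move=> _; apply/lfunP => x; rewrite !comp_lfunE to_modelK. Qed.

Lemma transport_sheaf_isomorphic : sheaf_isomorphic F transport_sheaf.
Proof.
exists (@SheafHom R X k F transport_sheaf _ to_model_res) => s.
by exists (of_model (M s)); [exact: to_modelK | exact: of_modelK].
Qed.

End Transport.

Theorem proposition8p3 (R : realType) (X : finite_regular_complex R)
    (I : signed_incidence X) (k : fieldType) (V : vectType k) (F : sheaf X k) :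
  is_approximation I 0 F (constant_sheaf X V) ->
  exists (F' : sheaf X k)
         (vertex_stalk : forall v : cells X, cell_dim v = 0 -> stalk F' v = V),
    sheaf_isomorphic F F' /\
    forall (e v w : cells X) (hv : cell_dim v = 0) (hw : cell_dim w = 0),
      cell_dim e = 1 -> v <> w -> v ⊴ e -> w ⊴ e ->
      stalk_eq_hom (vertex_stalk v hv) (res F' v e) =
      stalk_eq_hom (vertex_stalk w hw) (res F' w e).
Proof.
case=> a [abij _].
(* The equality of types is chosen together with the model, so that the cast
   in the conclusion reduces. *)
have models s : {M : stalk_model (stalk F s) &
    {E : cell_dim s = 0 -> model M = V |
      forall h, stalk_eq_hom (E h) (of_model M) = component a s}}.
  have [s0|s0] := eqVneq (cell_dim s) 0; last first.
    (* Away from vertices the stalk is kept, and the conditions on [E] are vacuous. *)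
    exists (trivial_model _).
    have E : cell_dim s = 0 -> model (trivial_model (stalk F s)) = V.
      by move=> h; rewrite h in s0.
    by exists E => h; exfalso; rewrite h in s0.
  have sbij : bijective (component a s) by apply: abij; rewrite s0.
  (* Here the model is [V] by definition and [of_model] is [component a s], so the cast along
     [erefl] disappears. *)
  by exists (bijective_model (component a s) sbij), (fun=> erefl).
pose M s := projT1 (models s).
exists (transport_sheaf R X k F M), (fun s => sval (projT2 (models s))).
split; first exact: transport_sheaf_isomorphic.
have resE e v hv : v ⊴ e ->
    stalk_eq_hom (sval (projT2 (models v)) hv) (transport_res R X k F M v e) =
    (to_model (M e) \o component a e)%VF.
  move=> ve; rewrite stalk_eq_hom_comp (svalP (projT2 (models v)) hv).
  (* In the naturality square the restriction of the constant sheaf is the identity. *)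
  by rewrite -comp_lfunA -(component_res a ve) comp_lfun1r.
by move=> e v w hv hw _ _ ve we; rewrite /= !resE.
Qed.
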